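(* Assume that the daily precipitation volumes on wet days, i.e. the random variables $X_1,X_2,\ldots$ (not necessarily independent and not necessarily identically distributed), satisfy, with some $\beta>0$ and $a>0$, the condition $$\frac{1}{n^\beta}\sum_{j=1}^nX_j\Longrightarrow a\qquad(n\to\infty).$$ Let the numbers $r>0$, $\alpha$ (real, nonzero) and $\lambda>0$ be arbitrary. For each $n\in\mathbb{N}$, let the random variable $N_{r,\alpha,\mu_n}$ have the generalized negative binomial (GNB) distribution with parameters $r$, $\alpha$ and $\mu_n=\lambda/n^\alpha$. Assume that the random variables $N_{r,\alpha,\mu_n}$ are independent of the sequence $X_1,X_2,\ldots$. Then $$\frac{a\,\lambda^{\beta/\alpha}}{n^{\beta}}\sum_{j=1}^{N_{r,\alpha,\lambda/n^\alpha}}X_j\Longrightarrow\overline{G}_{r,\alpha/\beta,1}\stackrel{d}{=}G_{r,1}^{\beta/\alpha}$$ as $n\to\infty$.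
   Context: The symbol $\Longrightarrow$ denotes convergence in distribution and $\stackrel{d}{=}$ equality in distribution. For $r>0$, $\gamma\neq 0$ real, $\mu>0$, $\overline{G}_{r,\gamma,\mu}$ denotes a random variable with the generalized gamma distribution, i.e. with density $g^*(x;r,\gamma,\mu)=\frac{|\gamma|\mu^r}{\Gamma(r)}x^{\gamma r-1}e^{-\mu x^\gamma}$, $x\ge 0$; $G_{r,1}\stackrel{d}{=}\overline{G}_{r,1,1}$ denotes a gamma random variable with density $\frac{1}{\Gamma(r)}x^{r-1}e^{-x}$. A random variable $N_{r,\gamma,\mu}$ has the GNB distribution with parameters $r,\gamma,\mu$ if $\mathbb{P}(N_{r,\gamma,\mu}=k)=\frac1{k!}\int_0^\infty e^{-z}z^k g^*(z;r,\gamma,\mu)\,dz$, $k=0,1,2,\ldots$. An empty sum equals $0$.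
   Formalization: The normalizing constant is corrected from aλ^{β/α}/n^β to λ^{β/α}/(a n^β); as printed the claim fails for every a ≠ 1 (with X_j = a and β = 1 the limit is a²G^{1/α}), and the two agree at a = 1. *)

(* Defs.v *)
From HB Require Import structures.
From mathcomp Require Import all_boot all_order all_algebra.
From mathcomp Require Import all_classical all_reals all_analysis measurable_realfun.

Set Implicit Arguments.
Unset Strict Implicit.
Unset Printing Implicit Defensive.

Import Order.TTheory GRing.Theory Num.Theory.
Import numFieldNormedType.Exports.

Local Open Scope classical_set_scope.
Local Open Scope ring_scope.

Definition cvg_in_distribution (R : realType)
    (d : measure_display) (T : measurableType d) (P : probability T R)
    (d' : measure_display) (T' : measurableType d') (P' : probability T' R)
    (X : nat -> {RV P >-> R}) (Y : {RV P' >-> R}) : Prop :=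
  forall x : R, {for x, continuous (cdf Y)} ->
    cdf (X n) x @[n --> \oo] --> cdf Y x.

Definition eq_in_distribution (R : realType)
    (d : measure_display) (T : measurableType d) (P : probability T R)
    (d' : measure_display) (T' : measurableType d') (P' : probability T' R)
    (X : {RV P >-> R}) (Y : {RV P' >-> R}) : Prop :=
  forall A : set R, measurable A -> distribution P X A = distribution P' Y A.

Definition has_density (R : realType)
    (d : measure_display) (T : measurableType d) (P : probability T R)
    (X : {RV P >-> R}) (f : R -> R) : Prop :=
  forall A : set R, measurable A ->
    distribution P X A = (\int[lebesgue_measure]_(x in A) (f x)%:E)%E.

Definition Gamma (R : realType) (r : R) : R :=
  \int[lebesgue_measure]_(x in `]0, +oo[) (x `^ (r - 1) * expR (- x)).

(* The value at the single point x = 0, where [powR] totalises 0 ^ s as 0 for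
   s != 0, is irrelevant for a density; gamma may be negative. *)
Definition gengamma_pdf (R : realType) (r gamma mu : R) : R -> R :=
  (fun x : R => `|gamma| * mu `^ r / Gamma r *
            x `^ (gamma * r - 1) * expR (- mu * x `^ gamma)) \_ `[0, +oo[.

Definition gamma_pdf (R : realType) (r : R) : R -> R :=
  (fun x : R => (Gamma r)^-1 * x `^ (r - 1) * expR (- x)) \_ `[0, +oo[.

Definition has_GNB_distribution (R : realType)
    (d : measure_display) (T : measurableType d) (P : probability T R)
    (N : {RV P >-> nat}) (r gamma mu : R) : Prop :=
  forall k : nat, P (N @^-1` [set k]) =
    ((k`!%:R^-1)%:E * \int[lebesgue_measure]_(z in `[0%R, +oo[)
       (expR (- z) * z ^+ k * gengamma_pdf r gamma mu z)%:E)%E.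

Definition independent_of_sequence (R : realType)
    (d : measure_display) (T : measurableType d) (P : probability T R)
    (N : {RV P >-> nat}) (X : nat -> {RV P >-> R}) : Prop :=
  forall (A : set nat) (B : set T), measurable A ->
    <<s \bigcup_j preimage_set_system setT (X j) measurable >> B ->
    P (N @^-1` A `&` B) = (P (N @^-1` A) * P B)%E.

Section RV_operations.
Context (R : realType) (d : measure_display) (T : measurableType d)
  (P : probability T R).

Definition random_sum_fun (X : nat -> {RV P >-> R}) (N : {RV P >-> nat}) :
  T -> R := fun t => \sum_(j < N t) X j t.

Lemma measurable_random_sum (X : nat -> {RV P >-> R}) (N : {RV P >-> nat}) :
  measurable_fun setT (random_sum_fun X N).
Proof.
move=> _ A mA; rewrite setTI.
have -> : random_sum_fun X N @^-1` A = \bigcup_n (N @^-1` [set n] `&`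
    (fun t => \sum_(j < n) X j t) @^-1` A).
  apply/seteqP; split => [t At|t [n _ [/= Ntn]]]; first by exists (N t).
  by rewrite /random_sum_fun /= Ntn.
apply: bigcup_measurable => n _; apply: measurableI.
  by rewrite -[X in measurable X]setTI; exact: measurable_funPT.
rewrite -[X in measurable X]setTI.
by apply: measurable_sum => // j; exact: measurable_funPT.
Qed.

HB.instance Definition _ X N := @isMeasurableFun.Build _ _ _ _
  (random_sum_fun X N) (measurable_random_sum X N).

(* The sequence is indexed from 0, so this is X 0 + ... + X (N - 1). *)
Definition random_sum (X : nat -> {RV P >-> R}) (N : {RV P >-> nat}) :
  {RV P >-> R} := random_sum_fun X N.

Definition partial_sum (X : nat -> {RV P >-> R}) (n : nat) : {RV P >-> R} :=
  random_sum X (cst n).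

Definition cst_RV (a : R) : {RV P >-> R} := cst a.

Definition scale_RV (c : R) (X : {RV P >-> R}) : {RV P >-> R} := c \o* X.

Definition powR_RV_fun (X : {RV P >-> R}) (s : R) : T -> R :=
  fun t => X t `^ s.

Lemma measurable_powR_RV (X : {RV P >-> R}) (s : R) :
  measurable_fun setT (powR_RV_fun X s).
Proof.
apply: (measurableT_comp (measurable_powR s)); exact: measurable_funPT.
Qed.

HB.instance Definition _ X s := @isMeasurableFun.Build _ _ _ _
  (powR_RV_fun X s) (measurable_powR_RV X s).

Definition powR_RV (X : {RV P >-> R}) (s : R) : {RV P >-> R} :=
  powR_RV_fun X s.

End RV_operations.

Arguments cst_RV {R d T} P a.

(* Main.v *)
Require Import Defs.
From HB Require Import structures.
From mathcomp Require Import all_boot all_order all_algebra.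
From mathcomp Require Import all_classical all_reals all_analysis measurable_realfun.
From mathcomp Require Import ring lra.

Set Implicit Arguments.
Unset Strict Implicit.
Unset Printing Implicit Defensive.

Import Order.TTheory GRing.Theory Num.Theory.
Import numFieldNormedType.Exports.

Local Open Scope classical_set_scope.
Local Open Scope ring_scope.

(** Let g be the gamma density with parameter r, let u be distributed according
    to g, and put w(u) = (u / lambda)^(1 / alpha). The generalized gamma law with
    parameters r, gamma, m is the law of (u / m)^(1 / gamma), by the substitution
    z = m x^gamma. Two consequences are drawn from this.

    On the one hand the limit law, with parameters r, alpha / beta, 1, is the law
    of G^(beta / alpha), which is the second claim
    ([gengamma_eq_powR_gamma]). On the other hand the GNB variable N_n is Poisson
    with the random intensity n w(u) ([GNB_poisson_mixture]): passing from n = 1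
    to n only multiplies the intensity by n. Since N_n is independent of the
    summands, the distribution function of the normalized random sum at x is
    therefore the integral against g(u) of the Poisson averages, at intensity
    n w(u), of the distribution functions q_n(k) at x of the normalized sums of k
    terms ([cdf_scale_random_sum], [GNB_average]).

    A Poisson variable k with intensity n w satisfies k / n -> w, by the Chernoff
    bound ([poisson_mean_cvg]). By hypothesis the sum of the first k terms is
    close to a k^beta, so the normalized sum of k terms is close to
    lambda^(beta / alpha) w^beta = u^(beta / alpha) when k / n is close to w(u).
    Hence the Poisson averages tend to 1 if u^(beta / alpha) < x and to 0 if
    u^(beta / alpha) > x ([poisson_mean_scaled_sum_lt],
    [poisson_mean_scaled_sum_gt]). They are bounded by 1, and dominated
    convergence gives the limit P(G^(beta / alpha) <= x).

    Everything holds for both signs of alpha, and the integrability of g follows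
    from its being the density of G. *)

(** * The substitution z = c x^s on the positive half-line *)

Section power_substitution.
Context {R : realType}.
Implicit Types (c s p q x z : R) (f : R -> R).
Notation mu := (@lebesgue_measure R).

Lemma powR_gt0_continuous s x : 0 < x -> {for x, continuous (@powR R ^~ s)}.
Proof.
move=> x0; apply: differentiable_continuous; apply/derivable1_diffP.
by apply: derivable_powR; rewrite in_itv/= x0.
Qed.

Lemma powR_gt0_homo s : 0 < s ->
  {in Num.pos &, {homo (@powR R ^~ s) : x y / x < y}}.
Proof.
by move=> s0 x y; rewrite !posrE => x0 y0; apply: gt0_ltr_powR => //;
  rewrite nnegrE ltW.
Qed.

Lemma powR_lt0_homo s : s < 0 ->
  {in Num.pos &, {homo (@powR R ^~ s) : x y /~ x < y}}.
Proof.
move=> s0 x y; rewrite !posrE => x0 y0 xy.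
rewrite -(opprK s) (powRN x) (powRN y) ltf_pV2 ?posrE ?powR_gt0//.
by apply: powR_gt0_homo; rewrite ?posrE ?oppr_gt0.
Qed.

Lemma powRVK s x : s != 0 -> 0 <= x -> (x `^ s) `^ s^-1 = x.
Proof. by move=> s0 x0; rewrite -powRrM divff// powRr1. Qed.

Lemma powRKV s x : s != 0 -> 0 <= x -> (x `^ s^-1) `^ s = x.
Proof. by move=> s0 x0; rewrite -powRrM mulVf// powRr1. Qed.

Lemma is_derive_powscale c s x : 0 < x ->
  is_derive x 1 (fun y : R => c * y `^ s) (c * (s * x `^ (s - 1))).
Proof. by move=> x0; have ? := is_derive1_powR s x0; apply: is_deriveZ. Qed.

Lemma derive1_powscale c s x : 0 < x ->
  (fun y : R => c * y `^ s)^`()%classic x = c * (s * x `^ (s - 1)).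
Proof.
by move=> x0; rewrite derive1E; have ? := is_derive_powscale c s x0;
  rewrite derive_val.
Qed.

Lemma continuous_powscale c s x : 0 < x ->
  {for x, continuous (fun y : R => c * y `^ s)}.
Proof.
by move=> x0; apply: cvgM; [exact: cvg_cst|exact: powR_gt0_continuous].
Qed.

Lemma continuous_derive1_powscale c s x : 0 < x ->
  {for x, continuous (fun y : R => c * y `^ s)^`()%classic}.
Proof.
move=> x0; have h : {for x, continuous (fun y : R => (c * s) * y `^ (s - 1))}.
  exact: continuous_powscale.
rewrite /prop_for /continuous_at derive1_powscale// mulrA.
apply: cvg_trans h; apply: near_eq_cvg; near=> y.
rewrite derive1_powscale ?mulrA//.
by near: y; exact: lt_nbhsr.
Unshelve. all: by end_near. Qed.

Lemma itvcc_within_continuous p q f : 0 < p ->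
  {in `]0, +oo[%R, continuous f} -> {within `[p, q], continuous f}.
Proof.
move=> p0 cf; apply: continuous_in_subspaceT => x; rewrite inE/= in_itv/= =>
  /andP[px _].
by apply: cf; rewrite in_itv/= andbT (lt_le_trans p0).
Qed.

(** The preimage of a compact interval of positive numbers under the inverse of
    x |-> c x^s, written so that it does not depend on the sign of s. *)
Definition powimage c s p q : set R :=
  `]0, +oo[ `&` (fun z => (z / c) `^ s^-1) @^-1` `[p, q].

Lemma powimage_gt0 c s p q : 0 < c -> 0 < s -> 0 < p -> 0 < q ->
  powimage c s p q = `[c * p `^ s, c * q `^ s]%classic.
Proof.
move=> c0 s0 p0 q0; have sn0 : s != 0 by rewrite gt_eqF.
have si0 : 0 <= s^-1 by rewrite invr_ge0 ltW.
apply/seteqP; split => z; rewrite /powimage /= !in_itv/=.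
  rewrite andbT => -[z0 /andP[h1 h2]].
  have zc0 : 0 <= z / c by rewrite divr_ge0 ?ltW.
  rewrite -(ler_pdivlMl _ _ c0) -(ler_pdivrMl _ _ c0) mulrC.
  rewrite -(powRKV sn0 zc0).
  by rewrite !ge0_ler_powR ?nnegrE ?powR_ge0 ?(ltW s0) ?(ltW p0) ?(ltW q0).
move=> /andP[h1 h2].
have z0 : 0 < z by rewrite (lt_le_trans _ h1)// mulr_gt0 ?powR_gt0.
split; first by rewrite z0.
have zc0 : 0 <= z / c by rewrite divr_ge0 ?ltW.
move: h1 h2; rewrite -(ler_pdivlMl _ _ c0) -(ler_pdivrMl _ _ c0) mulrC => h1 h2.
apply/andP; split.
  rewrite -(powRVK sn0 (ltW p0)).
  by rewrite ge0_ler_powR ?nnegrE ?powR_ge0 ?(ltW s0) ?(ltW p0) ?(ltW q0).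
rewrite -[leRHS](powRVK sn0 (ltW q0)).
by rewrite ge0_ler_powR ?nnegrE ?powR_ge0 ?(ltW s0) ?(ltW p0) ?(ltW q0).
Qed.

Lemma powimageN c s p q : 0 < c -> 0 < p -> 0 < q ->
  powimage c s p q = powimage c (- s) q^-1 p^-1.
Proof.
move=> c0 p0 q0; apply/seteqP; split => z; rewrite /powimage /= !in_itv/= andbT.
  move=> [z0 /andP[h1 h2]]; split => //; rewrite invrN powRN.
  have w0 : 0 < (z / c) `^ s^-1 by rewrite powR_gt0 ?divr_gt0.
  by rewrite !lef_pV2 ?posrE// h1 h2.
move=> [z0]; have w0 : 0 < (z / c) `^ s^-1 by rewrite powR_gt0 ?divr_gt0.
by rewrite invrN powRN !lef_pV2 ?posrE// => /andP[h1 h2]; rewrite h1 h2.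
Qed.

Lemma powimage_lt0 c s p q : 0 < c -> s < 0 -> 0 < p -> 0 < q ->
  powimage c s p q = `[c * q `^ s, c * p `^ s]%classic.
Proof.
move=> c0 s0 p0 q0; rewrite powimageN// powimage_gt0 ?oppr_gt0 ?invr_gt0//.
have invN x : 0 < x -> x^-1 `^ (- s) = x `^ s.
  by move=> x0; rewrite -powR_inv1 ?ltW// -powRrM mulN1r opprK.
by rewrite !invN.
Qed.

Lemma integral_powR_substitution_cc c s p q f :
  0 < c -> s != 0 -> 0 < p -> p <= q ->
  {in `]0, +oo[%R, continuous f} ->
  (\int[mu]_(z in powimage c s p q) (f z)%:E =
   \int[mu]_(x in `[p, q]) (f (c * x `^ s) * (c * (`|s| * x `^ (s - 1))))%:E)%E.
Proof.
move=> c0 s0 p0 pq cf; have q0 := lt_le_trans p0 pq.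
pose F := fun y : R => c * y `^ s.
have Fgt0 x : 0 < x -> 0 < F x by move=> x0; rewrite mulr_gt0 ?powR_gt0.
have itv_gt0 x : x \in `[p, q]%R -> 0 < x.
  by rewrite in_itv/= => /andP[px _]; exact: lt_le_trans px.
have itvo_gt0 x : x \in `]p, q[%R -> 0 < x.
  by rewrite in_itv/= => /andP[px _]; exact: lt_trans px.
have dF x : x \in `]p, q[%R -> {for x, continuous F^`()%classic}.
  by move=> /itvo_gt0 x0; exact: continuous_derive1_powscale.
have dFp : cvg (F^`()%classic x @[x --> p^'+]).
  by apply/cvg_ex; exists (F^`()%classic p); apply: cvg_at_right_filter;
     exact: continuous_derive1_powscale.
have dFq : cvg (F^`()%classic x @[x --> q^'-]).
  by apply/cvg_ex; exists (F^`()%classic q); apply: cvg_at_left_filter;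
     exact: continuous_derive1_powscale.
have FLR : derivable_oo_LRcontinuous F p q.
  split.
  - by move=> x /itvo_gt0 x0; have [] := is_derive_powscale c s x0.
  - by apply: cvg_at_right_filter; exact: continuous_powscale.
  - by apply: cvg_at_left_filter; exact: continuous_powscale.
have [sgt0|slt0|/eqP] := ltgtP 0 s; last by rewrite eq_sym (negPf s0).
- rewrite powimage_gt0// (@integration_by_substitution_increasing _ F f)//.
  + apply: eq_integral => x; rewrite inE/= => /itv_gt0 x0; congr EFin.
    by rewrite !fctE /= derive1_powscale// gtr0_norm.
  + move=> x y /itv_gt0 x0 /itv_gt0 y0 xy; rewrite /F ltr_pM2l//.
    by apply: powR_gt0_homo; rewrite ?posrE.
  + by apply: itvcc_within_continuous => //; exact: Fgt0.
- rewrite powimage_lt0// (@integration_by_substitution_decreasing _ F f)//.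
  + apply: eq_integral => x; rewrite inE/= => /itv_gt0 x0; congr EFin.
    rewrite !fctE /= derive1_powscale// ltr0_norm//; congr (_ * _).
    by rewrite mulNr mulrN.
  + move=> x y /itv_gt0 x0 /itv_gt0 y0 xy; rewrite /F ltr_pM2l//.
    by apply: powR_lt0_homo; rewrite ?posrE.
  + by apply: itvcc_within_continuous => //; exact: Fgt0.
Qed.

(** The intervals [1 / (n + 1), n + 1], which exhaust the positive half-line. *)
Definition exhaust (n : nat) : set R := `[n.+1%:R^-1, n.+1%:R]%classic.

Lemma nondecreasing_exhaust : nondecreasing_seq exhaust.
Proof.
move=> m n mn; apply/subsetPset => x; rewrite /exhaust /= !in_itv/= =>
  /andP[h1 h2].
apply/andP; split; last by rewrite (le_trans h2)// ler_nat.
by rewrite (le_trans _ h1)// lef_pV2 ?posrE// ler_nat.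
Qed.

Lemma bigcup_exhaust : \bigcup_n exhaust n = `]0, +oo[%classic.
Proof.
apply/seteqP; split => x /=.
  move=> [n _]; rewrite /exhaust /= !in_itv/= andbT => /andP[+ _].
  by apply: lt_le_trans; rewrite invr_gt0.
rewrite in_itv/= andbT => x0.
exists (maxn (Num.truncn x) (Num.truncn x^-1)) => //;
  rewrite /exhaust /= in_itv/=; apply/andP; split.
  rewrite -[leRHS]invrK lef_pV2 ?posrE ?invr_gt0//.
  by rewrite (le_trans (ltW (truncnS_gt _)))// ler_nat ltnS leq_maxr.
by rewrite (le_trans (ltW (truncnS_gt _)))// ler_nat ltnS leq_maxl.
Qed.

Lemma measurable_pos_continuous f : {in `]0, +oo[%R, continuous f} ->
  measurable_fun (`]0, +oo[%classic : set R) f.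
Proof.
move=> cf; apply: open_continuous_measurable_fun; first exact: interval_open.
by move=> x; rewrite inE; exact: cf.
Qed.

Lemma measurable_powimage c s p q : measurable (powimage c s p q).
Proof.
apply: measurableI => //.
have m : measurable_fun setT (fun z => (z / c) `^ s^-1).
  apply: (measurableT_comp (measurable_powR s^-1)).
  by apply: measurable_funM.
by rewrite -[X in measurable X]setTI; exact: m.
Qed.

(** The case of compact intervals passes to the limit along [exhaust] on the
    x side and along its images on the z side. *)
Lemma integral_powR_substitution c s f : 0 < c -> s != 0 ->
  {in `]0, +oo[%R, continuous f} -> {in `]0, +oo[%R, forall x, 0 <= f x} ->
  (\int[mu]_(z in `]0%R, +oo[) (f z)%:E =
   \int[mu]_(x in `]0%R, +oo[)
     (f (c * x `^ s) * (c * (`|s| * x `^ (s - 1))))%:E)%E.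
Proof.
move=> c0 s0 cf f0.
pose H x := f (c * x `^ s) * (c * (`|s| * x `^ (s - 1))).
have mpos x : 0 < x -> c * x `^ s \in `]0, +oo[%R.
  by move=> x0; rewrite in_itv/= andbT mulr_gt0 ?powR_gt0.
have cH : {in `]0, +oo[%R, continuous H}.
  move=> x; rewrite in_itv/= andbT => x0; apply: cvgM.
    apply: (@continuous_comp _ _ _ (fun x => c * x `^ s) f).
      exact: continuous_powscale.
    exact/cf/mpos.
  apply: cvgM; first exact: cvg_cst.
  exact: continuous_powscale.
have H0 : {in `]0, +oo[%R, forall x, 0 <= H x}.
  move=> x; rewrite in_itv/= andbT => x0;
    rewrite /H !mulr_ge0 ?powR_ge0 ?(ltW c0)//.
  by rewrite f0 ?mpos.
pose E n := powimage c s n.+1%:R^-1 n.+1%:R.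
have Ec : \bigcup_n E n = `]0, +oo[%classic.
  rewrite /E /powimage -setI_bigcupr.
  apply/seteqP; split => x /=; first by case.
  move=> x0; split => //.
  have : (\bigcup_n exhaust n) ((x / c) `^ s^-1).
    rewrite bigcup_exhaust /= in_itv/= andbT powR_gt0// divr_gt0//.
    by move: x0; rewrite in_itv/= andbT.
  by move=> [n _ hn]; exists n.
have Esub n : E n `<=` `]0, +oo[ by move=> x [].
have exsub n : exhaust n `<=` `]0, +oo[.
  by rewrite -bigcup_exhaust; exact: bigcup_sup.
have l1 : (\int[mu]_(z in E n) (f z)%:E @[n --> \oo] -->
    \int[mu]_(z in `]0%R, +oo[) (f z)%:E)%E.
  rewrite -Ec; apply: ge0_nondecreasing_set_cvg_integral.
  - move=> m n mn; apply/subsetPset => x -[x0 hx]; split => //.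
    by have /subsetPset := nondecreasing_exhaust mn; apply.
  - by move=> n; exact: measurable_powimage.
  - move=> n; apply/measurable_EFinP.
    exact: measurable_funS (measurable_pos_continuous cf).
  - by move=> n x /Esub x0; rewrite lee_fin f0.
have l2 : (\int[mu]_(z in exhaust n) (H z)%:E @[n --> \oo] -->
    \int[mu]_(z in `]0%R, +oo[) (H z)%:E)%E.
  rewrite -bigcup_exhaust; apply: ge0_nondecreasing_set_cvg_integral.
  - exact: nondecreasing_exhaust.
  - by move=> n; exact: measurable_itv.
  - move=> n; apply/measurable_EFinP.
    exact: measurable_funS (measurable_pos_continuous cH).
  - by move=> n x /exsub x0; rewrite lee_fin H0.
apply: cvg_unique l1 _ => //.
apply: cvg_trans l2; apply: near_eq_cvg; near=> n.
have n1 : n.+1%:R^-1 <= n.+1%:R :> R.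
  by rewrite (@le_trans _ _ 1)// ?invf_le1 ?ler1n.
by rewrite /E /exhaust integral_powR_substitution_cc ?invr_gt0.
Unshelve. all: by end_near. Qed.

End power_substitution.

(** * Concentration of Poisson averages *)

Section poisson_concentration.
Context {R : realType}.
Implicit Types (z w v theta m : R) (f g : nat -> R).

(** Expectation of f under the Poisson distribution with parameter z > 0. *)
Definition poisson_mean z f : \bar R :=
  (\sum_(k <oo) (poisson_pmf z k * f k)%:E)%E.

Let term_ge0 z f : (forall k, 0 <= f k) ->
  forall k, (0 <= (poisson_pmf z k * f k)%:E)%E.
Proof. by move=> f0 k; rewrite lee_fin mulr_ge0 ?poisson_pmf_ge0. Qed.

Lemma poisson_mean_ge0 z f : (forall k, 0 <= f k) -> (0 <= poisson_mean z f)%E.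
Proof. by move=> f0; apply: nneseries_ge0 => k _ _; exact: term_ge0. Qed.

Lemma le_poisson_mean z f g : (forall k, 0 <= f k) -> (forall k, f k <= g k) ->
  (poisson_mean z f <= poisson_mean z g)%E.
Proof.
move=> f0 fg; apply: lee_nneseries => [k _ _|k _]; first exact: term_ge0.
by rewrite lee_fin ler_wpM2l ?poisson_pmf_ge0.
Qed.

Lemma poisson_meanD z f g : (forall k, 0 <= f k) -> (forall k, 0 <= g k) ->
  (poisson_mean z (fun k => f k + g k)%R =
    poisson_mean z f + poisson_mean z g)%E.
Proof.
move=> f0 g0; rewrite /poisson_mean -nneseriesD.
- by apply: eq_eseriesr => k _; rewrite mulrDr EFinD.
- by move=> k _ _; exact: term_ge0.
- by move=> k _ _; exact: term_ge0.
Qed.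

Lemma poisson_mean_cst z (c : R) : 0 < z -> 0 <= c ->
  poisson_mean z (fun=> c) = c%:E.
Proof.
move=> z0 c0; have : poisson_prob z 0 setT = 1%E by exact: probability_setT.
rewrite /poisson_prob z0 -nneseries_esumT; last first.
  by move=> k; rewrite lee_fin poisson_pmf_ge0.
move=> h; rewrite /poisson_mean.
under eq_eseriesr do rewrite mulrC EFinM.
rewrite nneseriesZl; last by move=> k _; rewrite lee_fin poisson_pmf_ge0.
by rewrite h mule1.
Qed.

Lemma poisson_mean_le1 z f : 0 < z -> (forall k, 0 <= f k <= 1) ->
  (poisson_mean z f <= 1)%E.
Proof.
move=> z0 f01; rewrite -[leRHS](@poisson_mean_cst z 1)//.
by apply: le_poisson_mean => k; have /andP[] := f01 k.
Qed.

(** Exponential tilting: reweighting a Poisson law by theta^k gives again a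
    Poisson law. *)
Lemma poisson_pmf_tilt z theta k : 0 < z -> 0 < theta ->
  poisson_pmf z k =
  poisson_pmf (z * theta) k * expR (z * (theta - 1) - k%:R * ln theta).
Proof.
move=> z0 t0; rewrite /poisson_pmf z0 mulr_gt0//.
rewrite [expR (_ - k%:R * _)]expRB expRM_natl lnK ?posrE// exprMn.
have -> : expR (- z) = expR (- (z * theta)) * expR (z * (theta - 1)).
  by rewrite -expRD; congr expR; ring.
by field; rewrite expf_neq0 ?gt_eqF// ltr0n fact_gt0.
Qed.

(** The Chernoff bound for an event on which theta^k is at least exp(m). *)
Lemma poisson_chernoff z theta m (S : pred nat) : 0 < z -> 0 < theta ->
  (forall k, S k -> m <= k%:R * ln theta) ->
  (poisson_mean z (fun k => (S k)%:R)%R <= (expR (z * (theta - 1) - m)%R)%:E)%E.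
Proof.
move=> z0 t0 Sm; set c := expR _.
rewrite -[leRHS](@poisson_mean_cst (z * theta) c) ?expR_ge0 ?mulr_gt0//.
apply: lee_nneseries => [k _ _|k _].
  by rewrite lee_fin mulr_ge0 ?poisson_pmf_ge0.
rewrite lee_fin; case: (boolP (S k)) => [/Sm Smk|_]; last first.
  by rewrite mulr0 mulr_ge0 ?poisson_pmf_ge0 ?expR_ge0.
rewrite mulr1 (poisson_pmf_tilt k z0 t0) ler_wpM2l ?poisson_pmf_ge0//.
by rewrite ler_expR lerB.
Qed.

(** Positivity of the Chernoff exponent obtained with theta = v / w. *)
Lemma poisson_rate_gt0 w v : 0 < w -> 0 < v -> v != w ->
  0 < v * ln (v / w) - (v - w).
Proof.
move=> w0 v0 vw; have wv0 : 0 < w / v by rewrite divr_gt0.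
have : 1 + ln (w / v) < w / v.
  rewrite -[ltRHS](lnK wv0) expR_gt1Dx// ln_eq0//.
  by apply: contra vw => /eqP h; rewrite -[w](divfK (lt0r_neq0 v0)) h mul1r.
rewrite -(ltr_pM2l v0) mulrDr mulr1 mulrCA divff ?gt_eqF// mulr1.
have -> : ln (v / w) = - ln (w / v) by rewrite -lnV ?posrE// invf_div.
lra.
Qed.

Lemma poisson_tail_right w v n : 0 < w -> w < v -> (0 < n)%N ->
  (poisson_mean (n%:R * w)%R (fun k => (n%:R * v < k%:R)%R%:R)%R <=
   (expR (- (v * ln (v / w) - (v - w)) * n%:R))%:E)%E.
Proof.
move=> w0 wv n0; have v0 := lt_trans w0 wv.
have t0 : 0 < v / w by rewrite divr_gt0.
have n0' : 0 < n%:R :> R by rewrite ltr0n.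
apply: le_trans (@poisson_chernoff _ _ (n%:R * v * ln (v / w)) _ _ t0 _) _.
- by rewrite mulr_gt0.
- move=> k nvk; rewrite ler_wpM2r ?ltW//.
  by rewrite ln_gt0// ltr_pdivlMr// mul1r.
rewrite lee_fin ler_expR le_eqVlt; apply/orP; left; apply/eqP.
by field; rewrite gt_eqF.
Qed.

Lemma poisson_tail_left w v n : 0 < v -> v < w -> (0 < n)%N ->
  (poisson_mean (n%:R * w)%R (fun k => (k%:R < n%:R * v)%R%:R)%R <=
   (expR (- (v * ln (v / w) - (v - w)) * n%:R))%:E)%E.
Proof.
move=> v0 vw n0; have w0 := lt_trans v0 vw.
have t0 : 0 < v / w by rewrite divr_gt0.
have n0' : 0 < n%:R :> R by rewrite ltr0n.
apply: le_trans (@poisson_chernoff _ _ (n%:R * v * ln (v / w)) _ _ t0 _) _.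
- by rewrite mulr_gt0.
- move=> k nvk; rewrite ler_wnM2r ?ltW//.
  by rewrite ln_lt0// t0/= ltr_pdivrMr// mul1r.
rewrite lee_fin ler_expR le_eqVlt; apply/orP; left; apply/eqP.
by field; rewrite gt_eqF.
Qed.

Lemma cvg_expRN_nat (e : R) : 0 < e ->
  expR (- e * n%:R) @[n --> \oo] --> (0 : R).
Proof.
move=> e0; under eq_fun do rewrite expRM_natr.
apply: cvg_expr; rewrite ger0_norm ?expR_ge0// expR_lt1; lra.
Qed.

(** Poisson averaging: if k is Poisson with parameter n w, then k / n lies in any
    window around w up to an exponentially small probability, so that only the
    limit of q n k for k / n in that window matters. *)
Lemma poisson_mean_cvg (q : nat -> nat -> R) (l w v1 v2 : R) :
  (forall n k, 0 <= q n k <= 1) -> 0 <= l <= 1 ->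
  0 < v1 -> v1 < w -> w < v2 ->
  (forall e, 0 < e -> \forall n \near \oo, forall k,
    n%:R * v1 <= k%:R <= n%:R * v2 -> `|q n k - l| <= e) ->
  poisson_mean (n%:R * w) (q n) @[n --> \oo] --> l%:E.
Proof.
move=> q01 /andP[l0 l1] v10 v1w wv2 hq; have w0 := lt_trans v10 v1w.
pose r1 (n : nat) := expR (- (v1 * ln (v1 / w) - (v1 - w)) * n%:R).
pose r2 (n : nat) := expR (- (v2 * ln (v2 / w) - (v2 - w)) * n%:R).
have r10 : r1 n @[n --> \oo] --> (0 : R).
  by apply/cvg_expRN_nat/poisson_rate_gt0 => //; rewrite lt_eqF.
have r20 : r2 n @[n --> \oo] --> (0 : R).
  by apply/cvg_expRN_nat/poisson_rate_gt0; rewrite ?gt_eqF// (lt_trans w0).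
have q0 n k : 0 <= q n k by have /andP[] := q01 n k.
have q1 n k : q n k <= 1 by have /andP[] := q01 n k.
have fin n : (0 < n)%N -> poisson_mean (n%:R * w) (q n) \is a fin_num.
  move=> n0; rewrite ge0_fin_numE ?poisson_mean_ge0//.
  by rewrite (le_lt_trans (poisson_mean_le1 _ _)) ?ltry// mulr_gt0// ltr0n.
apply/cvg_EFin; first by near=> n; apply: fin; near: n; exact: nbhs_infty_gt.
apply/cvgrPdist_le => e e0.
have e20 : 0 < e / 2 by rewrite divr_gt0.
have e40 : 0 < e / 4 by rewrite divr_gt0.
move/cvgrPdist_le : r10 => /(_ _ e40) r10.
move/cvgrPdist_le : r20 => /(_ _ e40) r20.
near=> n.
have n0 : (0 < n)%N by near: n; exact: nbhs_infty_gt.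
have nw0 : 0 < n%:R * w by rewrite mulr_gt0 ?ltr0n.
have hr1 : r1 n <= e / 4.
  suff : `|0 - r1 n| <= e / 4 by rewrite sub0r normrN ger0_norm ?expR_ge0.
  by near: n; exact: r10.
have hr2 : r2 n <= e / 4.
  suff : `|0 - r2 n| <= e / 4 by rewrite sub0r normrN ger0_norm ?expR_ge0.
  by near: n; exact: r20.
have inner k : n%:R * v1 <= k%:R <= n%:R * v2 -> `|q n k - l| <= e / 2.
  by move: k; near: n; exact: hq.
pose lo k : R := (k%:R < n%:R * v1)%R%:R.
pose hi k : R := (n%:R * v2 < k%:R)%R%:R.
have lo0 k : 0 <= lo k by rewrite /lo.
have hi0 k : 0 <= hi k by rewrite /hi.
(* Inside the window q is within e / 2 of l; outside of it the trivial bound 1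
   is paid for by one of the two tail indicators. *)
have window k : `|q n k - l| <= e / 2 + (lo k + hi k).
  rewrite /lo /hi; case: ltP => h1 /=.
    have : 0 <= (n%:R * v2 < k%:R)%R%:R :> R by [].
    have := q0 n k; have := q1 n k; rewrite ler_norml; lra.
  case: ltP => h2 /=; last by rewrite !addr0 inner// h1 h2.
  have := q0 n k; have := q1 n k; rewrite ler_norml; lra.
have tails :
    (poisson_mean (n%:R * w)%R (fun k => lo k + hi k)%R <= (e / 2)%:E)%E.
  rewrite poisson_meanD//.
  apply: (@le_trans _ _ ((r1 n)%:E + (r2 n)%:E)%E).
    by apply: leeD; [exact: poisson_tail_left|exact: poisson_tail_right].
  rewrite -EFinD lee_fin; lra.
have fq := fin _ n0.
have h1 : (poisson_mean (n%:R * w)%R (q n) <= (l + e)%:E)%E.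
  apply: (@le_trans _ _ (poisson_mean (n%:R * w)%R (fun k =>
    (l + e / 2) + (lo k + hi k))%R)).
    apply: le_poisson_mean => // k; have := window k; rewrite ler_norml; lra.
  rewrite poisson_meanD; [|by move=> _; lra|by move=> k; exact: addr_ge0].
  rewrite poisson_mean_cst//; last lra.
  by apply: (le_trans (leeD (lexx _) tails)); rewrite -EFinD lee_fin; lra.
have h2 : (l%:E <= poisson_mean (n%:R * w)%R (q n) + e%:E)%E.
  rewrite -(@poisson_mean_cst (n%:R * w))//.
  apply: (@le_trans _ _ (poisson_mean (n%:R * w)%R (fun k =>
    q n k + (e / 2 + (lo k + hi k))))).
    apply: le_poisson_mean => // k; have := window k; rewrite ler_norml; lra.
  have le0 k : 0 <= lo k + hi k by exact: addr_ge0.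
  rewrite poisson_meanD//; last by move=> k; rewrite addr_ge0// ltW.
  rewrite leeD2l// poisson_meanD//; last by move=> _; exact: ltW.
  rewrite poisson_mean_cst// ?(ltW e20)//.
  by apply: (le_trans (leeD (lexx _) tails)); rewrite -EFinD lee_fin; lra.
move: h1 h2; rewrite /= -(fineK fq) -EFinD !lee_fin => h1 h2.
rewrite ler_norml; lra.
Unshelve. all: by end_near. Qed.

End poisson_concentration.

(** * Normalized sums of a fixed number of terms *)

Section partial_sums.
Context {R : realType} {d : measure_display} {T : measurableType d}
  (P : probability T R) (X : nat -> {RV P >-> R}).
Implicit Types (a beta x y c C w : R) (n k : nat).

Lemma cdf_fin_num (Z : {RV P >-> R}) y : cdf Z y \is a fin_num.
Proof. exact: fin_num_measure. Qed.

Lemma fine_cdf_itv (Z : {RV P >-> R}) y : 0 <= fine (cdf Z y) <= 1.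
Proof.
by rewrite fine_ge0 ?cdf_ge0//= -lee_fin fineK ?cdf_fin_num// cdf_le1.
Qed.

Lemma le_fine_cdf (Z : {RV P >-> R}) :
  {homo (fun y => fine (cdf Z y)) : x y / x <= y}.
Proof. by move=> x y xy; rewrite fine_le ?cdf_fin_num// cdf_nondecreasing. Qed.

Lemma cdf_cst_RV a y : cdf (cst_RV P a) y = ((a <= y)%R%:R)%:E.
Proof.
rewrite /cdf /distribution /pushforward /cst_RV preimage_cst.
rewrite mem_setE in_itv/=; case: (a <= y)%R.
  by rewrite probability_setT.
by rewrite measure0.
Qed.

Lemma cdf_cst_RV_continuous a y : y != a ->
  {for y, continuous (cdf (cst_RV P a))}.
Proof.
move=> ya; rewrite /prop_for /continuous_at.
have : cdf (cst_RV P a) y @[z --> y] --> cdf (cst_RV P a) y by exact: cvg_cst.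
apply: cvg_trans; apply: near_eq_cvg.
move: ya; rewrite neq_lt => /orP[ya|ay]; near=> z; rewrite !cdf_cst_RV.
  have za : z < a by near: z; exact: lt_nbhsl.
  by rewrite !leNgt ya za.
have az : a < z by near: z; exact: lt_nbhsr.
by rewrite !ltW.
Unshelve. all: by end_near. Qed.

(** Renormalizing the sum of k terms from the scale n^beta to the scale
    k^beta. *)
Lemma cdf_scale_partial_sum a beta C x n k :
  0 < a -> 0 < C -> (0 < n)%N -> (0 < k)%N ->
  cdf (scale_RV (C / (a * n%:R `^ beta)) (partial_sum X k)) x =
  cdf (scale_RV (k%:R `^ beta)^-1 (partial_sum X k))
      (x / C * a * (n%:R / k%:R) `^ beta).
Proof.
move=> a0 C0 n0 k0; rewrite /cdf /distribution /pushforward; congr (P _).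
have nb : 0 < n%:R `^ beta :> R by rewrite powR_gt0 ?ltr0n.
have kb : 0 < k%:R `^ beta :> R by rewrite powR_gt0 ?ltr0n.
have -> : (n%:R / k%:R) `^ beta = n%:R `^ beta / k%:R `^ beta.
  by rewrite powRM ?invr_ge0// -powR_inv1// -powRrM mulN1r powRN.
apply/seteqP; split => t; rewrite /preimage /scale_RV /= !in_itv/=;
  rewrite ler_pdivrMr// -ler_pdivlMr ?divr_gt0 ?mulr_gt0//;
  by congr (_ <= _); field; rewrite !gt_eqF.
Qed.

Hypotheses (beta a : R) (beta0 : 0 < beta) (a0 : 0 < a).
Hypothesis hX : cvg_in_distribution
  (fun n => scale_RV (n%:R `^ beta)^-1 (partial_sum X n)) (cst_RV P a).

Let Tk k := scale_RV (k%:R `^ beta)^-1 (partial_sum X k).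

Lemma cvg_fine_cdf_partial_sum y : y != a ->
  fine (cdf (Tk k) y) @[k --> \oo] --> ((a <= y)%R%:R : R).
Proof.
move=> ya; have := hX (cdf_cst_RV_continuous ya).
by rewrite cdf_cst_RV => /fine_cvg.
Qed.

(** Distribution function at x of the sum of k terms, multiplied by
    C / (a n^beta). *)
Definition cdf_scaled_sum C x n k : R :=
  fine (cdf (scale_RV (C / (a * n%:R `^ beta)) (partial_sum X k)) x).

Lemma window_large (v : R) (K : nat) : 0 < v ->
  \forall n \near \oo, forall k, n%:R * v <= k%:R -> (K < k)%N.
Proof.
move=> v0; near=> n => k; rewrite -(ltr_nat R); apply: lt_le_trans.
rewrite -ltr_pdivrMr//; near: n; exact: nbhs_infty_gtr.
Unshelve. all: by end_near. Qed.

(** For k / n <= v2 with v2^beta = m < x / C, the normalized sum of k terms is at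
    most x as soon as k^(-beta) S_k is at most y = (x / C) a / m, and y > a. *)
Lemma poisson_mean_scaled_sum_lt C x w : 0 < C -> 0 < w -> w `^ beta * C < x ->
  poisson_mean (n%:R * w) (cdf_scaled_sum C x n) @[n --> \oo]
    --> (1%E : \bar R).
Proof.
move=> C0 w0 wx; have b0 : beta != 0 by rewrite gt_eqF.
have wb0 : 0 < w `^ beta by rewrite powR_gt0.
have x0 : 0 < x by rewrite (lt_trans _ wx)// mulr_gt0.
have wxC : w `^ beta < x / C by rewrite ltr_pdivlMr.
pose m := (w `^ beta + x / C) / 2.
have m0 : 0 < m by rewrite divr_gt0// addr_gt0// divr_gt0.
have mxC : m < x / C by rewrite /m; lra.
have wm : w `^ beta < m by rewrite /m; lra.
pose v2 := m `^ beta^-1.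
have v20 : 0 < v2 by rewrite powR_gt0.
have v2b : v2 `^ beta = m by rewrite powRKV ?ltW.
have wv2 : w < v2.
  by rewrite -[ltLHS](@powRVK _ beta) ?ltW//
    gt0_ltr_powR ?invr_gt0 ?nnegrE ?ltW.
pose y := x / C * a / m.
have ay : a < y by rewrite /y ltr_pdivlMr// mulrC ltr_pM2r.
apply: (@poisson_mean_cvg _ _ 1 w (w / 2) v2) => //.
- by move=> n k; exact: fine_cdf_itv.
- by rewrite ler01 lexx.
- by rewrite divr_gt0.
- lra.
move=> e e0.
have := @cvg_fine_cdf_partial_sum y; rewrite gt_eqF// => /(_ isT).
rewrite (ltW ay) => /cvgrPdist_le /(_ _ e0) [K _ hK].
have w20 : 0 < w / 2 by rewrite divr_gt0.
near=> n => k /andP[h1 h2].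
have n0 : (0 < n)%N by near: n; exact: nbhs_infty_gt.
have Kk : (K < k)%N by move: k h1 {h2}; near: n; exact: window_large.
have k0 : (0 < k)%N by exact: leq_ltn_trans Kk.
have := hK k (ltnW Kk).
rewrite /= distrC /cdf_scaled_sum cdf_scale_partial_sum//.
have n0' : 0 < n%:R :> R by rewrite ltr0n.
have k0' : 0 < k%:R :> R by rewrite ltr0n.
have yle : y <= x / C * a * (n%:R / k%:R) `^ beta.
  rewrite /y ler_wpM2l ?mulr_ge0 ?invr_ge0 ?(ltW x0) ?(ltW C0) ?(ltW a0)//.
  have -> : m^-1 = v2^-1 `^ beta.
    by rewrite -(powR_inv1 (ltW v20)) -powRrM mulN1r powRN v2b.
  rewrite ge0_ler_powR ?nnegrE ?invr_ge0 ?divr_ge0 ?(ltW beta0) ?(ltW v20)//.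
  by rewrite ler_pdivlMr// ler_pdivrMl// mulrC.
have := le_fine_cdf (Tk k) yle.
have /andP[_ q1] := fine_cdf_itv (Tk k) (x / C * a * (n%:R / k%:R) `^ beta).
rewrite !ler_norml /Tk in q1 *; lra.
Unshelve. all: by end_near. Qed.

(** For k / n >= v1 with v1^beta = m > h, where h is the positive part of x / C,
    the normalized sum of k terms can be at most x only if k^(-beta) S_k is at
    most y = h a / m, and y < a. *)
Lemma poisson_mean_scaled_sum_gt C x w : 0 < C -> 0 < w -> x < w `^ beta * C ->
  poisson_mean (n%:R * w) (cdf_scaled_sum C x n) @[n --> \oo]
    --> (0%E : \bar R).
Proof.
move=> C0 w0 xw; have b0 : beta != 0 by rewrite gt_eqF.
have wb0 : 0 < w `^ beta by rewrite powR_gt0.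
have xCw : x / C < w `^ beta by rewrite ltr_pdivrMr.
pose h := Num.max 0 (x / C).
have h0 : 0 <= h by rewrite le_max lexx.
have xh : x / C <= h by rewrite le_max lexx orbT.
have hw : h < w `^ beta by rewrite gt_max wb0.
pose m := (w `^ beta + h) / 2.
have m0 : 0 < m by rewrite /m; lra.
have hm : h < m by rewrite /m; lra.
have mw : m < w `^ beta by rewrite /m; lra.
pose v1 := m `^ beta^-1.
have v10 : 0 < v1 by rewrite powR_gt0.
have v1b : v1 `^ beta = m by rewrite powRKV ?ltW.
have v1w : v1 < w.
  by rewrite -[ltRHS](@powRVK _ beta) ?ltW//
    gt0_ltr_powR ?invr_gt0 ?nnegrE ?ltW.
pose y := h * a / m.
have ya : y < a by rewrite /y ltr_pdivrMr// mulrC ltr_pM2l.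
apply: (@poisson_mean_cvg _ _ 0 w v1 (w + 1)) => //.
- by move=> n k; exact: fine_cdf_itv.
- by rewrite ler01 lexx.
- lra.
move=> e e0.
have := @cvg_fine_cdf_partial_sum y; rewrite lt_eqF// => /(_ isT).
rewrite leNgt ya => /cvgrPdist_le /(_ _ e0) [K _ hK].
near=> n => k /andP[h1 h2].
have n0 : (0 < n)%N by near: n; exact: nbhs_infty_gt.
have Kk : (K < k)%N by move: k h1 {h2}; near: n; exact: window_large.
have k0 : (0 < k)%N by exact: leq_ltn_trans Kk.
have := hK k (ltnW Kk).
rewrite /= distrC /cdf_scaled_sum cdf_scale_partial_sum//.
have n0' : 0 < n%:R :> R by rewrite ltr0n.
have k0' : 0 < k%:R :> R by rewrite ltr0n.
have yle : x / C * a * (n%:R / k%:R) `^ beta <= y.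
  apply: (@le_trans _ _ (h * a * (n%:R / k%:R) `^ beta)).
    by rewrite ler_wpM2r ?powR_ge0// ler_wpM2r ?(ltW a0).
  rewrite /y ler_wpM2l ?mulr_ge0 ?(ltW a0)//.
  have -> : m^-1 = v1^-1 `^ beta.
    by rewrite -(powR_inv1 (ltW v10)) -powRrM mulN1r powRN v1b.
  rewrite ge0_ler_powR ?nnegrE ?invr_ge0 ?divr_ge0 ?(ltW beta0) ?(ltW v10)//.
  by rewrite ler_pdivrMr// ler_pdivlMl// mulrC.
have := le_fine_cdf (Tk k) yle.
have /andP[q0 _] := fine_cdf_itv (Tk k) (x / C * a * (n%:R / k%:R) `^ beta).
rewrite !ler_norml /Tk in q0 *; lra.
Unshelve. all: by end_near. Qed.

End partial_sums.

(** * Sums of a random number of terms *)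

Section random_sum_mixture.
Context {R : realType} {d : measure_display} {T : measurableType d}
  (P : probability T R) (X : nat -> {RV P >-> R}).

(** Conditioning on the independent number of summands. *)
Lemma cdf_scale_random_sum (N : {RV P >-> nat}) (c x : R) :
  independent_of_sequence N X ->
  (cdf (scale_RV c (random_sum X N)) x =
   \sum_(k <oo) (P (N @^-1` [set k]) * cdf (scale_RV c (partial_sum X k)) x))%E.
Proof.
move=> NX; pose B k := [set t | partial_sum X k t * c <= x].
have E : scale_RV c (random_sum X N) @^-1` `]-oo, x] =
    \bigcup_k (N @^-1` [set k] `&` B k).
  apply/seteqP; split => t; rewrite /preimage /scale_RV /= in_itv/=.
    by move=> h; exists (N t).
  by move=> [k _ [/= Ntk]]; rewrite /B /= /random_sum /random_sum_fun/= Ntk.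
have mN k : measurable (N @^-1` [set k]).
  by rewrite -[X in measurable X]setTI; exact: measurable_funPT.
have mB k : measurable (B k).
  have -> : B k = scale_RV c (partial_sum X k) @^-1` `]-oo, x].
    by apply/seteqP; split => t; rewrite /B /preimage /scale_RV /= in_itv.
  by rewrite -[X in measurable X]setTI; exact: measurable_funPT.
rewrite /cdf /distribution /pushforward E measure_bigcup; last 2 first.
- by move=> k _; exact: measurableI.
- by move=> i j _ _ [t [[/= <- _] [/= -> _]]].
rewrite (@eq_eseriesl _ _ xpredT) => [|k]; last by rewrite in_setT.
apply: eq_eseriesr => k _.
transitivity (P (N @^-1` [set k]) * P (B k))%E; last by congr (_ * P _)%E.
(* B k belongs to the sigma-algebra generated by the summands. *)
apply: NX => //; pose G := \bigcup_j preimage_set_system setT (X j) measurable.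
have mX j : measurable_fun setT (X j : g_sigma_algebraType G -> R).
  by move=> _ A mA; apply: sub_sigma_algebra; exists j => //; exists A.
have mS : measurable_fun setT
    (fun t : g_sigma_algebraType G => (\sum_(j < k) X j t) * c).
  by apply: measurable_funM => //; apply: measurable_sum.
have := mS measurableT _ (measurable_itv `]-oo, x]).
by rewrite setTI.
Qed.

End random_sum_mixture.

(** * Laws on the positive half-line *)

Section positive_distributions.
Context {R : realType}.
Notation mu := (@lebesgue_measure R).
Implicit Types (r c s p q x z : R) (A : set R).

(** Two probability measures carried by the positive half-line are equal if they
    agree on its compact intervals. *)
Lemma eq_probability_pos (m1 m2 : probability R R) :
  (forall A, measurable A -> m1 A = m1 (A `&` `]0, +oo[)) ->
  (forall A, measurable A -> m2 A = m2 (A `&` `]0, +oo[)) ->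
  (forall p q, 0 < p -> p <= q -> m1 `[p, q]%classic = m2 `[p, q]%classic) ->
  forall A, measurable A -> m1 A = m2 A.
Proof.
move=> m1pos m2pos m12.
apply: (measure_unique (@RGenCInfty.G R) (fun k => `[- k%:R, +oo[%classic)) =>
  //.
- exact: RGenCInfty.measurableE.
- move=> _ _ [x ->] [y ->]; exists (Num.max x y).
  by apply/seteqP; split => z; rewrite /= !in_itv/= !andbT ge_max => /andP.
- by move=> k; exists (- k%:R).
- apply/seteqP; split => // x _; exists (Num.truncn (- x)).+1 => //=.
  by rewrite in_itv/= andbT lerNl ltW// truncnS_gt.
- move=> _ [a ->].
  transitivity (m1 (`[a, +oo[ `&` `]0, +oo[)); first exact: m1pos.
  transitivity (m2 (`[a, +oo[ `&` `]0, +oo[)); last by apply/esym/m2pos.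
  rewrite -bigcup_exhaust setI_bigcupr.
  have mF n : measurable (`[a, +oo[ `&` exhaust n : set R).
    by apply: measurableI => //; exact: measurable_itv.
  have ndF : nondecreasing_seq (fun n => `[a, +oo[ `&` exhaust n : set R).
    move=> i j ij; apply/subsetPset => z -[az zi]; split => //.
    by have /subsetPset := @nondecreasing_exhaust R _ _ ij; apply.
  have mcup : measurable (\bigcup_n (`[a, +oo[ `&` exhaust n : set R)).
    exact: bigcupT_measurable.
  have c1 := @nondecreasing_cvg_mu _ _ _ m1 _ mF mcup ndF.
  have c2 := @nondecreasing_cvg_mu _ _ _ m2 _ mF mcup ndF.
  apply: cvg_unique c1 _ => //.
  apply: cvg_trans c2; apply: near_eq_cvg; apply: nearW => n /=.
  have -> : (`[a, +oo[ `&` exhaust n : set R) =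
      `[Num.max a n.+1%:R^-1, n.+1%:R]%classic.
    apply/seteqP; split => z; rewrite /exhaust /= !in_itv/= andbT ge_max.
      by move=> [-> /andP[-> ->]].
    by move=> /andP[/andP[-> ->] ->].
  have [h|h] := leP (Num.max a n.+1%:R^-1) n.+1%:R.
    by rewrite m12// lt_max invr_gt0 ltr0n orbT.
  by rewrite set_itv_ge ?measure0// bnd_simp -ltNge.
- by move=> k; rewrite (le_lt_trans (probability_le1 _ _)) ?ltry.
Qed.

(** The point 0 is negligible, so that a density on the nonnegative half-line
    may be integrated over the positive one, where it is continuous. *)
Lemma distribution_pos_density (d : measure_display) (T : measurableType d)
    (P : probability T R) (Z : {RV P >-> R}) (f : R -> R) :
  {in `]0, +oo[%R, continuous f} ->
  has_density Z (f \_ `[0, +oo[) ->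
  forall A, measurable A ->
    distribution P Z A = (\int[mu]_(x in A `&` `]0%R, +oo[) (f x)%:E)%E.
Proof.
move=> cf dZ A mA; rewrite dZ//.
transitivity (\int[mu]_(x in A) ((EFin \o f) \_ `[0%R, +oo[) x)%E.
  by rewrite restrict_EFin.
rewrite -integral_mkcondr.
have -> : A `&` `]0, +oo[ = (A `&` `[0, +oo[) `\ 0.
  by rewrite setDE -setIA -setDE setDitv1l.
rewrite integral_setD1//.
- by apply: measurableD => //; exact: measurableI.
- rewrite setDE -setIA -setDE setDitv1l; apply/measurable_EFinP.
  by apply: measurable_funS (measurable_pos_continuous cf) => //;
    exact: subIsetr.
Qed.

End positive_distributions.

(** * Gamma, generalized gamma and GNB laws *)

Section gamma_laws.
Context {R : realType}.
Notation mu := (@lebesgue_measure R).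
Implicit Types (r c s p q x z gamma : R) (A : set R).

(** The gamma density as a formula on the whole line, meaningful at positive
    arguments. *)
Definition gamma_density r u : R := (Gamma r)^-1 * u `^ (r - 1) * expR (- u).

(** The generalized gamma density as a formula on the whole line, meaningful at
    positive arguments. *)
Definition gengamma_density r gamma m x : R :=
  `|gamma| * m `^ r / Gamma r * x `^ (gamma * r - 1) * expR (- m * x `^ gamma).

Lemma Gamma_ge0 r : 0 <= Gamma r.
Proof.
by apply: Rintegral_ge0 => x _; rewrite mulr_ge0 ?powR_ge0 ?expR_ge0.
Qed.

Lemma gamma_density_ge0 r u : 0 <= gamma_density r u.
Proof. by rewrite !mulr_ge0 ?powR_ge0 ?expR_ge0 ?invr_ge0 ?Gamma_ge0. Qed.

(** The generalized gamma density is the transform of the gamma density under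
    z = m x^gamma. *)
Lemma gengamma_density_subst r gamma m x : 0 < m -> 0 < x ->
  gengamma_density r gamma m x =
  gamma_density r (m * x `^ gamma) * (m * (`|gamma| * x `^ (gamma - 1))).
Proof.
move=> m0 x0; rewrite /gengamma_density /gamma_density.
rewrite powRM ?powR_ge0 ?(ltW m0)// -powRrM mulNr.
have -> : m `^ r = m `^ (r - 1) * m.
  by rewrite -[X in _ * X]powRr1 ?(ltW m0)// -powRD ?(gt_eqF m0) ?implybT//
    subrK.
have -> : x `^ (gamma * r - 1) = x `^ (gamma * (r - 1)) * x `^ (gamma - 1).
  by rewrite -powRD ?(gt_eqF x0) ?implybT//; congr (_ `^ _); ring.
ring.
Qed.

Lemma continuous_gamma_density r :
  {in `]0, +oo[%R, continuous (gamma_density r)}.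
Proof.
move=> u; rewrite in_itv/= andbT => u0; apply: cvgM; last first.
  by apply: continuous_comp; [exact: continuousN|exact: continuous_expR].
by apply: cvgM; [exact: cvg_cst|exact: powR_gt0_continuous].
Qed.

Lemma continuous_gengamma_density r gamma m :
  {in `]0, +oo[%R, continuous (gengamma_density r gamma m)}.
Proof.
move=> u; rewrite in_itv/= andbT => u0; apply: cvgM; last first.
  apply: (@continuous_comp _ _ _ (fun x => - m * x `^ gamma) expR).
    exact: continuous_powscale.
  exact: continuous_expR.
by apply: cvgM; [exact: cvg_cst|exact: powR_gt0_continuous].
Qed.

(** The generalized gamma law is the law of a power of a gamma variable. *)
Lemma gengamma_eq_powR_gamma r gamma
  (dY : measure_display) (TY : measurableType dY) (PY : probability TY R)
  (Y : {RV PY >-> R}) (hY : has_density Y (gengamma_pdf r gamma 1))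
  (dG : measure_display) (TG : measurableType dG) (PG : probability TG R)
  (G : {RV PG >-> R}) (hG : has_density G (gamma_pdf r)) :
  gamma != 0 -> eq_in_distribution Y (powR_RV G gamma^-1).
Proof.
move=> g0.
have dY_ :=
  distribution_pos_density (@continuous_gengamma_density r gamma 1) hY.
have dG_ := distribution_pos_density (@continuous_gamma_density r) hG.
have mpow A : measurable A -> measurable ((@powR R ^~ gamma^-1) @^-1` A).
  by move=> mA; rewrite -[X in measurable X]setTI; exact: measurable_powR.
have dGp A : measurable A -> distribution PG (powR_RV G gamma^-1) A =
    distribution PG G ((@powR R ^~ gamma^-1) @^-1` A) by [].
have posY A : measurable A ->
    distribution PY Y A = distribution PY Y (A `&` `]0, +oo[).
  by move=> mA; rewrite dY_// [RHS]dY_ -?setIA ?setIid//; exact: measurableI.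
have posG A : measurable A -> distribution PG (powR_RV G gamma^-1) A =
    distribution PG (powR_RV G gamma^-1) (A `&` `]0, +oo[).
  move=> mA; rewrite dGp// [RHS]dGp; last exact: measurableI.
  rewrite dG_; last exact: mpow.
  rewrite [RHS]dG_; last by apply: mpow; exact: measurableI.
  congr (integral _ _ _); apply/seteqP; split => u /=.
    by move=> [Au u0]; split => //; split => //;
      rewrite in_itv/= andbT powR_gt0//;
       move: u0; rewrite in_itv/= andbT.
  by move=> [[]].
suff cc p q : 0 < p -> p <= q -> distribution PY Y `[p, q]%classic =
    distribution PG (powR_RV G gamma^-1) `[p, q]%classic.
  by apply: eq_probability_pos => [||p q p0 pq];
    [exact: posY|exact: posG|exact: cc].
move=> p0 pq; rewrite dGp// dY_// dG_; last exact: mpow.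
have -> : `[p, q] `&` `]0, +oo[ = (`[p, q]%classic : set R).
  apply/setIidl => x /=; rewrite !in_itv/= andbT => /andP[px _].
  exact: lt_le_trans px.
have -> : (@powR R ^~ gamma^-1) @^-1` `[p, q] `&` `]0, +oo[ =
  powimage 1 gamma p q.
  by apply/seteqP; split => u; rewrite /powimage /= divr1 => -[].
rewrite integral_powR_substitution_cc//; last exact: continuous_gamma_density.
apply: eq_integral => x; rewrite inE/= in_itv/= => /andP[px _].
by rewrite gengamma_density_subst// (lt_le_trans p0).
Qed.

(** A GNB law is a Poisson law with random intensity (G / m)^(1 / gamma). *)
Lemma GNB_poisson_mixture r gamma m
  (d : measure_display) (T : measurableType d) (P : probability T R)
  (N : {RV P >-> nat}) k :
  gamma != 0 -> 0 < m -> has_GNB_distribution N r gamma m ->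
  P (N @^-1` [set k]) =
  (\int[mu]_(u in `]0%R, +oo[)
     (poisson_pmf ((u / m) `^ gamma^-1) k * gamma_density r u)%:E)%E.
Proof.
move=> g0 m0 ->.
pose h z : R := z ^+ k * k`!%:R^-1 * expR (- z).
have h0 z : 0 <= z -> 0 <= h z.
  by move=> z0; rewrite !mulr_ge0 ?exprn_ge0 ?expR_ge0.
have ch : continuous h.
  move=> z; apply: cvgM; last first.
    by apply: continuous_comp; [exact: continuousN|exact: continuous_expR].
  by apply: cvgM; [exact: exprn_continuous|exact: cvg_cst].
pose f u := h ((u / m) `^ gamma^-1) * gamma_density r u.
have cf : {in `]0, +oo[%R, continuous f}.
  move=> u u0; have u_gt0 : 0 < u by move: u0; rewrite in_itv/= andbT.
  apply: cvgM; last exact: continuous_gamma_density.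
  apply: (@continuous_comp R R R (fun u : R => (u / m) `^ gamma^-1) h);
    last exact: ch.
  apply: (@continuous_comp R R R (fun u : R => u / m) (@powR R ^~ gamma^-1)).
    by apply: cvgM; [exact: cvg_id|exact: cvg_cst].
  by apply: powR_gt0_continuous; rewrite divr_gt0.
have f0 : {in `]0, +oo[%R, forall u, 0 <= f u}.
  by move=> u _; rewrite mulr_ge0 ?h0 ?powR_ge0 ?gamma_density_ge0.
have -> : (\int[mu]_(u in `]0%R, +oo[)
    (poisson_pmf ((u / m) `^ gamma^-1) k * gamma_density r u)%:E =
    \int[mu]_(u in `]0%R, +oo[) (f u)%:E)%E.
  apply: eq_integral => u; rewrite inE/= in_itv/= andbT => u0.
  by rewrite /f /h /poisson_pmf powR_gt0// divr_gt0.
rewrite (integral_powR_substitution m0 g0 cf f0).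
have hE x : 0 < x -> f (m * x `^ gamma) * (m * (`|gamma| * x `^ (gamma - 1))) =
    h x * gengamma_density r gamma m x.
  move=> x0; rewrite gengamma_density_subst// /f.
  by rewrite [m * _ / m]mulrAC divff ?gt_eqF// mul1r powRVK ?(ltW x0)// mulrA.
pose g x := expR (- x) * x ^+ k * gengamma_density r gamma m x.
have g0_ x : 0 <= x -> 0 <= g x.
  move=> x0; rewrite /g /gengamma_density !mulr_ge0 ?exprn_ge0 ?powR_ge0
    ?expR_ge0//.
  by rewrite invr_ge0 Gamma_ge0.
have cg : {in `]0, +oo[%R, continuous g}.
  move=> x x0; apply: cvgM; last exact: continuous_gengamma_density.
  apply: cvgM; last exact: exprn_continuous.
  by apply: continuous_comp; [exact: continuousN|exact: continuous_expR].
transitivity ((k`!%:R^-1)%:E * \int[mu]_(x in `]0%R, +oo[) (g x)%:E)%E;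
  last first.
  rewrite -ge0_integralZl_EFin//.
  - apply: eq_integral => x; rewrite inE/= in_itv/= andbT => x0.
    by rewrite hE// -EFinM /g /h; congr EFin; ring.
  - by move=> x /=; rewrite in_itv/= andbT lee_fin => /ltW/g0_.
  - by apply/measurable_EFinP; exact: measurable_pos_continuous.
congr (_ * _)%E.
have mg := measurable_pos_continuous cg.
have gE x : x \in (`]0, +oo[%classic : set R) ->
    (expR (- x) * x ^+ k * gengamma_pdf r gamma m x)%:E = (g x)%:E.
  rewrite inE/= in_itv/= andbT => x0; rewrite /g /gengamma_pdf patchE.
  by rewrite mem_set//= in_itv/= andbT ltW.
rewrite -integral_itv_obnd_cbnd; last first.
  apply: (@eq_measurable_fun _ _ _ _ _ (EFin \o g));
    last exact/measurable_EFinP.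
  by move=> x x0; rewrite gE.
by apply: eq_integral => x; exact: gE.
Qed.

End gamma_laws.

(** * Gamma mixtures of Poisson averages *)

Section mixture_limit.
Context {R : realType}.
Notation mu := (@lebesgue_measure R).

Lemma cdf_powR_RV r s (d : measure_display) (T : measurableType d)
    (P : probability T R) (G : {RV P >-> R}) (x : R) :
  has_density G (gamma_pdf r) ->
  cdf (powR_RV G s) x =
  (\int[mu]_(u in `]0%R, +oo[) ((u `^ s <= x)%R%:R * gamma_density r u)%:E)%E.
Proof.
move=> hG.
have dG := distribution_pos_density (@continuous_gamma_density R r) hG.
pose B : set R := (@powR R ^~ s) @^-1` `]-oo, x].
have mB : measurable B.
  by rewrite -[X in measurable X]setTI; exact: measurable_powR.
transitivity (distribution P G B); first by [].
rewrite dG// setIC integral_mkcondr; apply: eq_integral => u _.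
rewrite patchE; case: ifPn => [|/negP] uB.
  by move: uB; rewrite inE /B /= in_itv/= => ->; rewrite mul1r.
suff /negbTE -> : ~~ (u `^ s <= x) by rewrite mul0r.
by apply/negP => h; apply: uB; rewrite inE /B /= in_itv.
Qed.

Lemma integrable_gamma_density r (d : measure_display) (T : measurableType d)
    (P : probability T R) (G : {RV P >-> R}) :
  has_density G (gamma_pdf r) ->
  mu.-integrable `]0, +oo[ (EFin \o gamma_density r).
Proof.
move=> hG.
have dG := distribution_pos_density (@continuous_gamma_density R r) hG.
apply/integrableP; split.
  apply/measurable_EFinP.
  exact: measurable_pos_continuous (@continuous_gamma_density R r).
under eq_integral do rewrite /= ger0_norm ?gamma_density_ge0//.
have := dG setT measurableT; rewrite setTI => <-.
by rewrite (le_lt_trans (probability_le1 _ _)) ?ltry.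
Qed.

(** Averages over a GNB-distributed index are gamma averages of Poisson
    averages. *)
Lemma GNB_average r gamma m
  (d : measure_display) (T : measurableType d) (P : probability T R)
  (N : {RV P >-> nat}) (q : nat -> R) :
  gamma != 0 -> 0 < m -> has_GNB_distribution N r gamma m ->
  (forall k, 0 <= q k) ->
  (\sum_(k <oo) (P (N @^-1` [set k]) * (q k)%:E) =
   \int[mu]_(u in `]0%R, +oo[)
     (poisson_mean ((u / m) `^ gamma^-1) q * (gamma_density r u)%:E))%E.
Proof.
move=> g0 m0 hN q0.
have mpow : measurable_fun setT (fun u : R => (u / m) `^ gamma^-1).
  by apply: (measurableT_comp (measurable_powR gamma^-1));
    exact: measurable_funM.
have mgd := measurable_pos_continuous (@continuous_gamma_density R r).
have mpmf k : measurable_fun (`]0, +oo[%classic : set R)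
    (fun u : R => poisson_pmf ((u / m) `^ gamma^-1) k).
  apply: measurable_funTS.
  exact: (measurableT_comp (measurable_poisson_pmf k measurableT)).
transitivity (\sum_(k <oo) \int[mu]_(u in `]0%R, +oo[)
    ((poisson_pmf ((u / m) `^ gamma^-1) k * gamma_density r u)%:E *
     (q k)%:E))%E.
  apply: eq_eseriesr => k _; rewrite (GNB_poisson_mixture k g0 m0 hN).
  rewrite -ge0_integralZr//.
  - by apply/measurable_EFinP; apply: measurable_funM => //; exact: mpmf.
  - by move=> u _; rewrite lee_fin mulr_ge0 ?poisson_pmf_ge0 ?gamma_density_ge0.
  - by rewrite lee_fin.
rewrite -integral_nneseries//; last 2 first.
- move=> k; apply/measurable_EFinP; apply: measurable_funM => //.
  by apply: measurable_funM => //; exact: mpmf.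
- move=> k u _; rewrite -EFinM lee_fin mulr_ge0//.
  by rewrite mulr_ge0 ?poisson_pmf_ge0 ?gamma_density_ge0.
apply: eq_integral => u _; rewrite muleC -nneseriesZl; last first.
  by move=> k _; rewrite lee_fin mulr_ge0 ?poisson_pmf_ge0.
by apply: eq_eseriesr => k _; rewrite -!EFinM; congr EFin; ring.
Qed.

Lemma measurable_poisson_mean (D : set R) (h : R -> R) (q : nat -> R) :
  measurable D -> measurable_fun D h -> (forall k, 0 <= q k) ->
  measurable_fun D (fun u => poisson_mean (h u) q).
Proof.
move=> mD mh q0.
have := @ge0_emeasurable_sum _ _ R D
  (fun k u => (poisson_pmf (h u) k * q k)%:E) xpredT.
apply.
- by move=> k u _ _; rewrite lee_fin mulr_ge0 ?poisson_pmf_ge0.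
- move=> k _; apply/measurable_EFinP; apply: measurable_funM => //.
  exact: (measurableT_comp (measurable_poisson_pmf k measurableT)).
Qed.

End mixture_limit.

(** * Convergence of the normalized random sums *)

Theorem theorem6 (R : realType)
  (d : measure_display) (T : measurableType d) (P : probability T R)
  (X : nat -> {RV P >-> R}) (beta a : R)
  (hbeta : 0 < beta) (ha : 0 < a)
  (hX : cvg_in_distribution
          (fun n => scale_RV (n%:R `^ beta)^-1 (partial_sum X n))
          (cst_RV P a))
  (r alpha lambda : R)
  (hr : 0 < r) (halpha : alpha != 0) (hlambda : 0 < lambda)
  (N : nat -> {RV P >-> nat})
  (hN : forall n : nat, (0 < n)%N ->
          has_GNB_distribution (N n) r alpha (lambda / n%:R `^ alpha))
  (hNX : forall n : nat, (0 < n)%N -> independent_of_sequence (N n) X)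
  (dY : measure_display) (TY : measurableType dY) (PY : probability TY R)
  (Y : {RV PY >-> R}) (hY : has_density Y (gengamma_pdf r (alpha / beta) 1))
  (dG : measure_display) (TG : measurableType dG) (PG : probability TG R)
  (G : {RV PG >-> R}) (hG : has_density G (gamma_pdf r)) :
  cvg_in_distribution
    (fun n => scale_RV (lambda `^ (beta / alpha) / (a * n%:R `^ beta))
                         (random_sum X (N n)))
    Y
  /\ eq_in_distribution Y (powR_RV G (beta / alpha)).
Proof.
have b0 : beta != 0 by rewrite gt_eqF.
have YG : eq_in_distribution Y (powR_RV G (beta / alpha)).
  rewrite -[beta / alpha]invf_div; apply: (gengamma_eq_powR_gamma hY hG).
  by rewrite mulf_neq0 ?invr_eq0.
split => // x _.
(* The limit law has no atom, so x is an arbitrary point. *)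
have -> : cdf Y x = cdf (powR_RV G (beta / alpha)) x by apply: YG.
rewrite (cdf_powR_RV _ _ hG).
set C := lambda `^ (beta / alpha).
have C0 : 0 < C by rewrite powR_gt0.
pose w u := (u / lambda) `^ alpha^-1.
have w0 u : 0 < u -> 0 < w u by move=> u0; rewrite powR_gt0 ?divr_gt0.
pose q n := cdf_scaled_sum X beta a C x n.
have q01 n k : 0 <= q n k <= 1 by exact: fine_cdf_itv.
have q0 n k : 0 <= q n k by have /andP[] := q01 n k.
pose F n u := (poisson_mean (n%:R * w u) (q n) * (gamma_density r u)%:E)%E.
have cdfE n : (0 < n)%N ->
    (cdf (scale_RV (C / (a * n%:R `^ beta)) (random_sum X (N n))) x =
     \int[lebesgue_measure]_(u in `]0%R, +oo[) F n u)%E.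
  move=> n0; have n0' : 0 < n%:R :> R by rewrite ltr0n.
  rewrite cdf_scale_random_sum; last exact: hNX.
  transitivity (\sum_(k <oo) (P (N n @^-1` [set k]) * (q n k)%:E))%E.
    by apply: eq_eseriesr => k _; rewrite /q /cdf_scaled_sum fineK ?cdf_fin_num.
  rewrite (GNB_average halpha _ (hN n n0) (q0 n)); last first.
    by rewrite divr_gt0 ?powR_gt0.
  apply: eq_integral => u; rewrite inE/= in_itv/= andbT => u0.
  suff -> : (u / (lambda / n%:R `^ alpha)) `^ alpha^-1 = n%:R * w u by [].
  rewrite invf_div mulrCA powRM ?powR_ge0 ?divr_ge0 ?(ltW u0) ?(ltW hlambda)//.
  by rewrite powRVK ?(ltW n0').
have w_pow u : 0 < u -> w u `^ beta * C = u `^ (beta / alpha).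
  move=> u0; rewrite /w /C -powRrM [_^-1 * _]mulrC -powRM ?divr_ge0 ?(ltW u0)
    ?(ltW hlambda)//.
  by rewrite divfK ?gt_eqF.
have F_cvg u : 0 < u -> u != x `^ (alpha / beta) ->
    F n u @[n --> \oo] -->
    ((u `^ (beta / alpha) <= x)%R%:R * gamma_density r u)%:E.
  move=> u0 ux; rewrite EFinM; apply: cvgeZr => //.
  have := w_pow u u0; case: ltgtP => [h|h|h] wE.
  - by apply: (poisson_mean_scaled_sum_lt hbeta ha hX) => //;
      [exact: w0|rewrite wE].
  - by apply: (poisson_mean_scaled_sum_gt hbeta ha hX) => //;
      [exact: w0|rewrite wE].
  - move: ux; rewrite -h -powRrM.
    have -> : beta / alpha * (alpha / beta) = 1 by field; rewrite b0 halpha.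
    by rewrite powRr1 ?eqxx// ltW.
(* The only point where u^(beta / alpha) may equal x is removed: there the
   Poisson averages need not converge. *)
pose D : set R := `]0, +oo[ `\ (x `^ (alpha / beta)).
have mD : measurable D by apply: measurableD.
have D0 u : D u -> 0 < u by move=> []; rewrite /= in_itv/= andbT.
have mgd : measurable_fun (`]0, +oo[%classic : set R) (gamma_density r).
  exact: measurable_pos_continuous (@continuous_gamma_density R r).
have mF n (A : set R) : measurable A -> A `<=` `]0, +oo[ ->
  measurable_fun A (F n).
  move=> mA A0; apply: emeasurable_funM.
    apply: measurable_poisson_mean => //; apply: measurable_funTS.
    apply: measurable_funM => //;
      apply: (measurableT_comp (measurable_powR alpha^-1)).
    exact: measurable_funM.
  by apply/measurable_EFinP; exact: measurable_funS mgd.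
have D_pos : D `<=` `]0, +oo[ by move=> u [].
have FD_cvg u : D u -> F n.+1 u @[n --> \oo] -->
    ((u `^ (beta / alpha) <= x)%R%:R * gamma_density r u)%:E.
  move=> Du; rewrite (cvg_shiftS (F ^~ u)).
  by apply: F_cvg; [exact: D0|case: Du => _ /eqP].
rewrite -(@integral_setD1 _ _ (x `^ (alpha / beta)))//; last first.
  by apply: (emeasurable_fun_cvg (fun n => F n.+1)) => // n; exact: mF.
(* At n = 0 the intensity vanishes and the bound by 1 of the Poisson averages
   is not available. *)
rewrite -cvg_shiftS.
have -> : (fun n => cdf (scale_RV (C / (a * n.+1%:R `^ beta))
                                  (random_sum X (N n.+1))) x) =
    (fun n => \int[lebesgue_measure]_(u in D) F n.+1 u)%E.
  by apply/funext => n; rewrite cdfE// integral_setD1//; exact: mF.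
apply: (@dominated_cvg _ _ _ lebesgue_measure D mD (fun n => F n.+1)
  (fun u => ((u `^ (beta / alpha) <= x)%R%:R * gamma_density r u)%:E)
  (EFin \o gamma_density r)) => //.
- by move=> n; exact: mF.
- by apply: integrableS (integrable_gamma_density hG).
move=> n u /D0 u0.
have F0 : (0 <= F n.+1 u)%E.
  by rewrite mule_ge0 ?poisson_mean_ge0 ?lee_fin ?gamma_density_ge0.
rewrite gee0_abs// /F /= -[leRHS]mul1e lee_wpmul2r ?lee_fin
  ?gamma_density_ge0//.
by rewrite poisson_mean_le1// mulr_gt0 ?w0.
Qed.
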